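(* Let $\tau\in\mathbb{Q}$ with $\tau\neq0,1$, and let $\mathbb{Q}_\tau$ be the weighted average quandle on $\mathbb{Q}$ with weight $\tau$. Then $\mathbb{Q}_\tau$ has nontrivial $\vartriangleright$-congruences, nontrivial $\vartriangleleft$-congruences, and nontrivial quandle congruences. Moreover: (1) If $\tau=-1$ then a relation on $\mathbb{Q}$ is a $\vartriangleright$-congruence if and only if it is a $\vartriangleleft$-congruence. (2) If $\tau^{-1}\in\mathbb{Z}$ and $\tau\neq-1$, then every $\vartriangleright$-congruence on $\mathbb{Q}_\tau$ is a $\vartriangleleft$-congruence, but not every $\vartriangleleft$-congruence is a $\vartriangleright$-congruence. (3) If $\tau\in\mathbb{Z}$ and $\tau\neq-1$, then every $\vartriangleleft$-congruence on $\mathbb{Q}_\tau$ is a $\vartriangleright$-congruence, but not every $\vartriangleright$-congruence is a $\vartriangleleft$-congruence. (4) If $\tau,\tau^{-1}\notin\mathbb{Z}$ then there exists a $\vartriangleright$-congruence on $\mathbb{Q}_\tau$ that is not a $\vartriangleleft$-congruence, and a $\vartriangleleft$-congruence that is not a $\vartriangleright$-congruence.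
   Context: For $\tau\in\mathbb{Q}$, $\tau\ne0$, the weighted average quandle $\mathbb{Q}_\tau$ has underlying set $\mathbb{Q}$ and operation $x\vartriangleright y=\tau x+(1-\tau)y$; its inverse operation is $x\vartriangleleft y=\tau^{-1}x+(1-\tau^{-1})y$. For a binary operation $*$ on a set $M$, a $*$-congruence on $M$ is an equivalence relation $\sim$ on $M$ such that $a\sim c$ and $b\sim d$ imply $a*b\sim c*d$, for all $a,b,c,d\in M$. A quandle congruence is an equivalence relation that is both a $\vartriangleright$-congruence and a $\vartriangleleft$-congruence. A congruence is nontrivial if it is neither the equality relation nor the relation with a single equivalence class. *)

(* Defs.v *)
From Stdlib Require Import RelationClasses.
From mathcomp Require Import all_boot all_order all_algebra.
From mathcomp Require Import ring.
Set Implicit Arguments.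
Unset Strict Implicit.
Unset Printing Implicit Defensive.
Import Order.TTheory GRing.Theory Num.Theory.
Local Open Scope ring_scope.

Definition wavg (tau x y : rat) : rat := tau * x + (1 - tau) * y.

Definition wavg_inv (tau x y : rat) : rat := tau^-1 * x + (1 - tau^-1) * y.

(* [wavg_inv] is inverse to [wavg] in the left argument, the right argument
   being fixed. *)
Lemma wavgK (tau : rat) (tau_neq0 : tau != 0) (y : rat) :
  cancel (wavg tau ^~ y) (wavg_inv tau ^~ y).
Proof. by move=> x; rewrite /wavg_inv /wavg; field. Qed.

Lemma wavg_invK (tau : rat) (tau_neq0 : tau != 0) (y : rat) :
  cancel (wavg_inv tau ^~ y) (wavg tau ^~ y).
Proof. by move=> x; rewrite /wavg_inv /wavg; field. Qed.

(* Congruences are arbitrary [Prop]-valued relations, not only decidable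
   ones. *)
Definition op_congruence (M : Type) (op : M -> M -> M) (r : M -> M -> Prop) :
    Prop :=
  Equivalence r /\
  (forall a b c d : M, r a c -> r b d -> r (op a b) (op c d)).

Definition quandle_congruence (M : Type) (op op_inv : M -> M -> M)
    (r : M -> M -> Prop) : Prop :=
  op_congruence op r /\ op_congruence op_inv r.

(* Meant for equivalence relations on a nonempty type, where relating all
   pairs means having a single class. *)
Definition nontrivial_rel (M : Type) (r : M -> M -> Prop) : Prop :=
  ~ (forall x y : M, r x y <-> x = y) /\ ~ (forall x y : M, r x y).

(* Main.v *)
Require Import Defs.
From mathcomp Require Import all_boot all_order all_algebra.
From mathcomp Require Import ring.
Set Implicit Arguments.
Unset Strict Implicit.
Unset Printing Implicit Defensive.
Import Order.TTheory GRing.Theory Num.Theory.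
Local Open Scope ring_scope.

(** If [a] and [c] are congruent, then letting [b] vary in
    [tau * a + (1 - tau) * b] shows that any two points differing by
    [tau * (a - c)] are congruent; varying the left argument instead gives the
    same for [(1 - tau) * (a - c)], and composing the two steps gives it for
    [a - c].  So a congruence is the coset relation of an additive subgroup
    of the rationals, and this subgroup is closed under multiplication by
    [tau].  Conversely every such subgroup gives a congruence
    ([wavg_congruenceP]).  The inverse operation is the weighted average of
    weight [tau^-1], so everything reduces to comparing the subgroups stable
    under [tau] with those stable under [tau^-1].

    If [tau^-1] is an integer, every subgroup is stable under it
    ([int_weight_congruence]).  If [tau^-1] is not an integer, some prime [l]
    divides its denominator.  The local ring of fractions with denominator
    prime to [l] then omits [tau^-1], hence contains [tau] because it is a
    valuation ring; it is thus stable under [tau] but not under [tau^-1]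
    ([congruence_not_inv]).  Finally, when [l] divides neither denominator, the
    local ring is stable under both, and it is a proper nonzero subgroup
    ([nontrivial_quandle_congruence]).  The statements about the inverse
    operation follow on exchanging [tau] and [tau^-1]. *)

(** * Congruences as stable subgroups *)

Definition stable_subgroup (tau : rat) (A : rat -> Prop) : Prop :=
  [/\ A 0, forall x y, A x -> A y -> A (x - y) & forall x, A x -> A (tau * x)].

Definition coset_rel (A : rat -> Prop) (x y : rat) : Prop := A (x - y).

Lemma stable_subgroup_congruence (tau : rat) (A : rat -> Prop)
    (r : rat -> rat -> Prop) :
  stable_subgroup tau A -> (forall x y, r x y <-> A (x - y)) ->
  op_congruence (wavg tau) r.
Proof.
case=> A0 AB Atau rE.
have AN x : A x -> A (- x) by move=> Ax; rewrite -sub0r; exact: AB.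
have AD x y : A x -> A y -> A (x + y).
  by move=> Ax Ay; rewrite -[y]opprK; apply: AB => //; exact: AN.
split; first split.
- by move=> x; apply/rE; rewrite subrr.
- by move=> x y /rE /AN xy; apply/rE; rewrite -opprB.
- move=> x y z /rE xy /rE yz; apply/rE.
  by rewrite -(subrK y x) -addrA; exact: AD.
move=> a b c d /rE ac /rE bd; apply/rE.
have -> : wavg tau a b - wavg tau c d =
    tau * (a - c) + ((b - d) - tau * (b - d)) by rewrite /wavg; ring.
by apply: AD; [exact: Atau | apply: AB => //; exact: Atau].
Qed.

(** Since [tau] and [1 - tau] are invertible, the free argument of the
    operation realises every translation. *)
Lemma congruence_translate (tau : rat) (r : rat -> rat -> Prop) :
  tau != 0 -> tau != 1 -> op_congruence (wavg tau) r ->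
  forall a c t, r a c -> r (a + t) (c + t) /\ r (tau * a + t) (tau * c + t).
Proof.
move=> tau0 tau1 [[rR rS rT] rC] a c t ac.
have ctau0 : 1 - tau != 0 by rewrite subr_eq0 eq_sym.
have left_step s : r (tau * a + s) (tau * c + s).
  have := rC a ((1 - tau)^-1 * s) c _ ac (rR _).
  by rewrite /wavg !mulrA divff // mul1r.
have right_step s : r ((1 - tau) * a + s) ((1 - tau) * c + s).
  have := rC (tau^-1 * s) a _ c (rR _) ac.
  by rewrite /wavg !mulrA divff // mul1r ![s + _]addrC.
split; last exact: left_step.
(* The point [tau * c + (1 - tau) * a] splits the move from [a] to [c]
   into a multiple by [tau] followed by a multiple by [1 - tau]. *)
have -> : a + t = tau * a + ((1 - tau) * a + t) by ring.
have -> : c + t = (1 - tau) * c + (tau * c + t) by ring.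
apply: (rT _ _ _ (left_step _)).
have -> : tau * c + ((1 - tau) * a + t) = (1 - tau) * a + (tau * c + t) by ring.
exact: right_step.
Qed.

Lemma wavg_congruenceP (tau : rat) (r : rat -> rat -> Prop) :
  tau != 0 -> tau != 1 ->
  op_congruence (wavg tau) r <->
  stable_subgroup tau (r^~ 0) /\ (forall x y, r x y <-> r (x - y) 0).
Proof.
move=> tau0 tau1; split; last by case; exact: stable_subgroup_congruence.
move=> rC; have tr := congruence_translate tau0 tau1 rC.
case: rC => -[rR rS rT] _.
have rE x y : r x y <-> r (x - y) 0.
  split=> xy; first by have [] := tr _ _ (- y) xy; rewrite subrr.
  by have [] := tr _ _ y xy; rewrite subrK add0r.
split=> //; split=> [|x y x0 y0|x x0]; first exact: rR.
- by apply: (rE x y).1; exact: rT x0 (rS _ _ y0).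
- by have [_] := tr _ _ 0 x0; rewrite mulr0 !addr0.
Qed.

Lemma subgroup_mulz (tau : rat) (A : rat -> Prop) (m : int) (x : rat) :
  stable_subgroup tau A -> A x -> A (m%:~R * x).
Proof.
case=> A0 AB _ Ax.
have AN y : A y -> A (- y) by move=> Ay; rewrite -sub0r; exact: AB.
have An (n : nat) : A (n%:R * x).
  elim: n => [|n IHn]; first by rewrite mul0r.
  have -> : n.+1%:R * x = n%:R * x - - x.
    by rewrite opprK -natr1 mulrDl mul1r.
  by apply: AB => //; exact: AN.
case: m => n; first exact: An.
by rewrite NegzE rmorphN mulNr; apply: AN; exact: An.
Qed.

Lemma int_weight_congruence (tau : rat) (r : rat -> rat -> Prop) :
  tau != 0 -> tau != 1 -> tau^-1 \is a Num.int ->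
  op_congruence (wavg tau) r -> op_congruence (wavg tau^-1) r.
Proof.
move=> tau0 tau1 /intrP[m tauVE] /(wavg_congruenceP _ tau0 tau1)[rA rE].
apply: (@stable_subgroup_congruence _ (r^~ 0)) rE.
have rM x := @subgroup_mulz _ _ m x rA.
case: rA => r0 rB _; split=> [//||x x0]; first exact: rB.
by rewrite tauVE; exact: rM.
Qed.

(** * Localization of the integers at a prime *)

(** The valuation ring of the [l]-adic valuation on the rationals, when [l] is
    prime. *)
Definition local_int (l : nat) (x : rat) : bool := ~~ (l %| `|denq x|)%N.

Section LocalInt.
Variables (l : nat) (l_prime : prime l).

(** Any denominator prime to [l], reduced or not, certifies membership; this
    avoids computing the reduced denominators of sums and products. *)
Lemma local_int_witness (x : rat) (d : int) :
  ~~ (l %| `|d|)%N -> x * d%:~R \is a Num.int -> local_int l x.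
Proof.
move=> ld /intrP[n xdE]; apply/negP => lden.
have : numq x * d = n * denq x.
  by apply: (@intr_inj rat); rewrite !rmorphM /= -xdE numqE; ring.
move=> /(congr1 absz); rewrite !abszM => numdE.
have : (l %| `|numq x| * `|d|)%N by rewrite numdE dvdn_mull.
rewrite Euclid_dvdM // (negPf ld) orbF => lnum.
have : (l %| gcdn `|numq x| `|denq x|)%N by rewrite dvdn_gcd lnum.
by rewrite (eqP (coprime_num_den x)) dvdn1 gtn_eqF ?prime_gt1.
Qed.

Lemma local_intB (x y : rat) :
  local_int l x -> local_int l y -> local_int l (x - y).
Proof.
move=> lx ly; apply: (@local_int_witness _ (denq x * denq y)).
  by rewrite abszM Euclid_dvdM // negb_or; exact/andP.
have -> : (x - y) * (denq x * denq y)%:~R =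
    (numq x * denq y - numq y * denq x)%:~R.
  by rewrite rmorphB !rmorphM /= !numqE; ring.
exact: intr_int.
Qed.

Lemma local_intM (x y : rat) :
  local_int l x -> local_int l y -> local_int l (x * y).
Proof.
move=> lx ly; apply: (@local_int_witness _ (denq x * denq y)).
  by rewrite abszM Euclid_dvdM // negb_or; exact/andP.
have -> : x * y * (denq x * denq y)%:~R = (numq x * numq y)%:~R.
  by rewrite !rmorphM /= !numqE; ring.
exact: intr_int.
Qed.

Lemma local_int_int (m : int) : local_int l m%:~R.
Proof. by rewrite /local_int denq_int dvdn1 neq_ltn prime_gt1 ?orbT. Qed.

(** The valuation ring property: numerator and denominator of [x] are coprime,
    so if [l] divides the denominator it cannot divide the numerator, which
    is a denominator of [x^-1]. *)
Lemma local_intV (x : rat) : ~~ local_int l x -> local_int l x^-1.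
Proof.
rewrite negbK => lden.
have lnum : ~~ (l %| `|numq x|)%N.
  apply/negP => lnum.
  have : (l %| gcdn `|numq x| `|denq x|)%N by rewrite dvdn_gcd lnum.
  by rewrite (eqP (coprime_num_den x)) dvdn1 gtn_eqF ?prime_gt1.
apply: (local_int_witness lnum); rewrite numqE.
have [->|x0] := eqVneq x 0; first by rewrite invr0 mul0r rpred0.
by rewrite mulKf // intr_int.
Qed.

Lemma local_int_prime_inv : ~~ local_int l l%:R^-1.
Proof.
have l0 : l%:R != 0 :> rat by rewrite pnatr_eq0 -lt0n prime_gt0.
rewrite negbK; have : denq (l%:R^-1 : rat) = numq (l%:R^-1 : rat) * l%:Z.
  by apply: (@intr_inj rat); rewrite rmorphM /= numqE mulrAC mulVf // mul1r.
by move=> ->; rewrite abszM dvdn_mull.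
Qed.

Lemma local_int_stable (tau : rat) :
  local_int l tau -> stable_subgroup tau (local_int l).
Proof.
move=> ltau; split=> [|x y|x]; first exact: (local_int_int 0).
- exact: local_intB.
- exact: local_intM.
Qed.

Lemma local_int_congruence (tau : rat) :
  local_int l tau -> op_congruence (wavg tau) (coset_rel (local_int l)).
Proof. by move=> /local_int_stable/stable_subgroup_congruence; apply. Qed.

Lemma local_int_nontrivial : nontrivial_rel (coset_rel (local_int l)).
Proof.
split=> [eq_rel | /(_ l%:R^-1 0)].
  have /eq_rel/eqP : coset_rel (local_int l) 1 0.
    by rewrite /coset_rel subr0; exact: (local_int_int 1).
  by rewrite oner_eq0.
by rewrite /coset_rel subr0; exact/negP/local_int_prime_inv.
Qed.

End LocalInt.

(** * Existence of congruences and separation of the two operations *)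

Lemma nontrivial_quandle_congruence (tau : rat) :
  exists r : rat -> rat -> Prop,
    quandle_congruence (wavg tau) (wavg_inv tau) r /\ nontrivial_rel r.
Proof.
(* A prime exceeding both denominators divides neither. *)
have [l] := prime_above (maxn `|denq tau| `|denq tau^-1|).
rewrite gtn_max => /andP[l_tau l_tauV] l_prime.
have local_lt x : (`|denq x| < l)%N -> local_int l x.
  rewrite ltnNge; apply: contra => lden; apply: dvdn_leq => //.
  by rewrite absz_gt0 denq_neq0.
exists (coset_rel (local_int l)); split; last exact: local_int_nontrivial.
by split; apply: local_int_congruence => //; exact: local_lt.
Qed.

Lemma congruence_not_inv (tau : rat) :
  tau != 0 -> tau != 1 -> tau^-1 \isn't a Num.int ->
  exists r : rat -> rat -> Prop,
    op_congruence (wavg tau) r /\ ~ op_congruence (wavg tau^-1) r.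
Proof.
move=> tau0 tau1; rewrite Qint_def => den1.
set l := pdiv `|denq tau^-1|.
have l_prime : prime l.
  by rewrite pdiv_prime // ltn_neqAle eq_sym absz_gt0 denq_neq0 andbT
    -eqz_nat absz_denq.
have tauV_notin : ~~ local_int l tau^-1 by rewrite negbK pdiv_dvd.
exists (coset_rel (local_int l)); split.
  by apply: local_int_congruence => //; rewrite -[tau]invrK; exact: local_intV.
have tauV0 : tau^-1 != 0 by rewrite invr_eq0.
have tauV1 : tau^-1 != 1 by rewrite invr_eq1.
move=> /(wavg_congruenceP _ tauV0 tauV1)[[_ _ /(_ 1)]].
rewrite /coset_rel !subr0 mulr1 => stab _.
by move/negP: tauV_notin; apply; apply: stab; exact: (local_int_int l_prime 1).
Qed.

Lemma int_inv_not_int (tau : rat) :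
  tau != 0 -> tau != 1 -> tau != -1 -> tau \is a Num.int ->
  tau^-1 \isn't a Num.int.
Proof.
move=> tau0 tau1 tauN1 /intrP[m tauE]; apply/negP => /intrP[n tauVE].
have /intUnitRing.unitzPl : n * m = 1.
  by apply: (@intr_inj rat); rewrite rmorphM /= -tauE -tauVE mulVf.
move=> /orP[] /eqP m1; first by rewrite tauE m1 eqxx in tau1.
by rewrite tauE m1 rmorphN eqxx in tauN1.
Qed.

Theorem theorem6p6 (tau : rat) (tau_neq0 : tau != 0) (tau_neq1 : tau != 1) :
  (exists r : rat -> rat -> Prop,
     op_congruence (wavg tau) r /\ nontrivial_rel r) /\
  (exists r : rat -> rat -> Prop,
     op_congruence (wavg_inv tau) r /\ nontrivial_rel r) /\
  (exists r : rat -> rat -> Prop,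
     quandle_congruence (wavg tau) (wavg_inv tau) r /\ nontrivial_rel r) /\
  (tau = -1 ->
     forall r : rat -> rat -> Prop,
       op_congruence (wavg tau) r <-> op_congruence (wavg_inv tau) r) /\
  (tau^-1 \is a Num.int -> tau != -1 ->
     (forall r : rat -> rat -> Prop,
        op_congruence (wavg tau) r -> op_congruence (wavg_inv tau) r) /\
     ~ (forall r : rat -> rat -> Prop,
          op_congruence (wavg_inv tau) r -> op_congruence (wavg tau) r)) /\
  (tau \is a Num.int -> tau != -1 ->
     (forall r : rat -> rat -> Prop,
        op_congruence (wavg_inv tau) r -> op_congruence (wavg tau) r) /\
     ~ (forall r : rat -> rat -> Prop,
          op_congruence (wavg tau) r -> op_congruence (wavg_inv tau) r)) /\
  (tau \isn't a Num.int -> tau^-1 \isn't a Num.int ->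
     (exists r : rat -> rat -> Prop,
        op_congruence (wavg tau) r /\ ~ op_congruence (wavg_inv tau) r) /\
     (exists r : rat -> rat -> Prop,
        op_congruence (wavg_inv tau) r /\ ~ op_congruence (wavg tau) r)).
Proof.
have tauV0 : tau^-1 != 0 by rewrite invr_eq0.
have tauV1 : tau^-1 != 1 by rewrite invr_eq1.
have [r [[rC rCV] rnt]] := nontrivial_quandle_congruence tau.
split; first by exists r.
split; first by exists r.
split; first by exists r.
split; first by move=> ->; rewrite -[wavg_inv (-1)]/(wavg (-1)^-1) invrN1.
rewrite -[wavg_inv tau]/(wavg tau^-1).
have noncong : tau^-1 \isn't a Num.int -> exists r : rat -> rat -> Prop,
    op_congruence (wavg tau) r /\ ~ op_congruence (wavg tau^-1) r.
  exact: congruence_not_inv.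
(* The statements with the two operations exchanged are those for [tau^-1]. *)
have noncongV : tau \isn't a Num.int -> exists r : rat -> rat -> Prop,
    op_congruence (wavg tau^-1) r /\ ~ op_congruence (wavg tau) r.
  by have := congruence_not_inv tauV0 tauV1; rewrite invrK.
split=> [tauV_int tauN1|].
  split=> [s|all_cong]; first exact: int_weight_congruence.
  have : tau \isn't a Num.int.
    rewrite -[tau]invrK; apply: int_inv_not_int => //.
    by rewrite -invrN1 (inj_eq invr_inj).
  by move=> /noncongV[s [/all_cong]].
split=> [tau_int tauN1|tau_nint tauV_nint]; last by split; auto.
split=> [s|all_cong].
  by have := @int_weight_congruence _ s tauV0 tauV1; rewrite invrK; apply.
by have /noncong[s [/all_cong]] : tau^-1 \isn't a Num.int
  by exact: int_inv_not_int.
Qed.
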